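(* Let $m$ be a nonnegative integer. Then $$(-1)^{m+1}\,2\left(1-3^{-2m-1}\right)\lambda(2m+2)=\frac{\pi^{2m+2}}{3^{2m+1}(2m+1)!}+4\sum_{k=0}^m(-1)^{k+1}\frac{\pi^{2m-2k}}{3^{2m-2k}(2m-2k)!}\,\lambda(2k+2).$$
   Context: The Dirichlet lambda function is $\lambda(s)=\sum_{n=0}^\infty\frac{1}{(2n+1)^s}$ for $\mathrm{Re}(s)>1$. *)

(* Defs.v *)
From Stdlib Require Import Reals.
From Coquelicot Require Import Coquelicot.

Open Scope R_scope.

Definition Cexp (z : C) : C :=
  (exp (Re z) * cos (Im z), exp (Re z) * sin (Im z)).

(* Principal complex power [a ^ s = exp (s * ln a)] of a real base [a > 0]. *)
Definition Rcpow (a : R) (s : C) : C := Cexp (s * RtoC (ln a))%C.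

Definition lambda_term (s : C) (n : nat) : C :=
  (1 / Rcpow (INR (2 * n + 1)) s)%C.

(* The Dirichlet lambda function on the half-plane [1 < Re s].  The sum of the
   complex series is taken componentwise; as [Series] is total, the value is
   meaningful only where the series converges, in particular for [1 < Re s]. *)
Definition lambda (s : C) : C :=
  (Series (fun n => Re (lambda_term s n)),
   Series (fun n => Im (lambda_term s n))).

(* Main.v *)
Require Import Defs.
From Stdlib Require Import Reals Factorial Lra Lia.
From Coquelicot Require Import Coquelicot.

(** Consider, for [m >= 0], the Fourier series
      [S_m(x) = sum_n cos((2n+1)x) / (2n+1)^(2m+2)].
    Evaluating it in two ways at [x = PI/3] gives the theorem.

    On the one hand, [cos((2n+1)PI/3)] is [-1] if [3] divides [2n+1] and [1/2]
    otherwise; the multiples of [3] contribute [3^(-2m-2)] times the whole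
    series, so [S_m(PI/3) = (1/2) (1 - 3^(-2m-1)) lambda(2m+2)]
    ([cos_sum_third_PI]).

    On the other hand, [S_m] is a polynomial on [[0, PI/2]].  For [m = 0] it is
    the triangle wave [PI/4 (PI/2 - x)] ([cos_sum2_uniform]).  Since
    [(-1)^(m+2) S_(m+1)] has second derivative [(-1)^(m+1) S_m], integrating
    twice from [0] at each step yields
      [(-1)^(m+1) S_m(x) = sum_(k <= m) (-1)^(k+1) lambda(2k+2)
          x^(2m-2k) / (2m-2k)! + PI/4 x^(2m+1) / (2m+1)!],
    because [S_m(0) = lambda(2m+2)] and [S_m'(0) = 0] for [m >= 1]
    ([is_lim_cos_sum]).

    To avoid differentiating series, everything is done on partial sums: the
    difference [taylor_gap] between the two sides, both truncated at [N], obeys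
    the second derivative relation exactly, so a bound on it for [m = 0],
    uniform in [x], propagates to all [m] by the mean value theorem
    ([taylor_gap_bound]).  The case [m = 0] rests on the Dirichlet kernel, which
    shows that [sum sin((2n+1)x)/(2n+1)] is nearly constant away from [0], and
    on the Leibniz series, which gives its value [PI/4] at [PI/2]. *)

(** * Finite sums over the odd integers *)

Definition odd_nat (n : nat) : R := INR (2 * n + 1).

Definition cos_sum (p N : nat) (x : R) : R :=
  sum_n (fun n => cos (odd_nat n * x) / odd_nat n ^ p) N.

Definition sin_sum (p N : nat) (x : R) : R :=
  sum_n (fun n => sin (odd_nat n * x) / odd_nat n ^ p) N.

Definition odd_sum (p N : nat) : R := sum_n (fun n => / odd_nat n ^ p) N.

(** Divided powers: normalized so that each is the derivative of the next. *)
Definition pow_fact (n : nat) (x : R) : R := x ^ n / INR (fact n).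

(** The equality is taken at type [R], not at the carrier of the abelian monoid
    over which [sum_n] is defined, so that [ring] and [lra] apply after
    rewriting; likewise for the next lemmas. *)
Lemma sum_n_S (f : nat -> R) (N : nat) :
  sum_n f (S N) = sum_n f N + f (S N) :> R.
Proof. exact (sum_Sn f N). Qed.

Lemma sum_n_R0 (f : nat -> R) : sum_n f 0 = f 0%nat :> R.
Proof. exact (sum_O f). Qed.

Lemma sum_n_eq (f g : nat -> R) (N : nat) :
  (forall n, (n <= N)%nat -> f n = g n) -> sum_n f N = sum_n g N :> R.
Proof. exact (sum_n_ext_loc f g N). Qed.

Lemma sum_n_eq0 (f : nat -> R) (N : nat) : (forall n, f n = 0) -> sum_n f N = 0 :> R.
Proof.
  intros H. induction N as [|N IH].
  - now rewrite sum_n_R0.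
  - rewrite sum_n_S, IH, H. ring.
Qed.

Lemma sum_n_opp (f : nat -> R) (N : nat) :
  sum_n (fun n => - f n) N = - sum_n f N :> R.
Proof.
  induction N as [|N IH].
  - now rewrite !sum_n_R0.
  - rewrite !sum_n_S, IH. ring.
Qed.

Lemma odd_nat_S (n : nat) : odd_nat (S n) = odd_nat n + 2.
Proof.
  unfold odd_nat. replace (2 * S n + 1)%nat with (S (S (2 * n + 1))) by lia.
  rewrite !S_INR. lra.
Qed.

Lemma odd_nat_ge1 (n : nat) : 1 <= odd_nat n.
Proof.
  unfold odd_nat. rewrite plus_INR. simpl (INR 1).
  generalize (pos_INR (2 * n)). lra.
Qed.

Lemma pow_odd_nat_gt0 (n p : nat) : 0 < odd_nat n ^ p.
Proof. apply pow_lt. generalize (odd_nat_ge1 n). lra. Qed.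

Lemma pow_odd_nat_neq0 (n p : nat) : odd_nat n ^ p <> 0.
Proof. generalize (pow_odd_nat_gt0 n p). lra. Qed.

Lemma cos_sum_at0 (p N : nat) : cos_sum p N 0 = odd_sum p N.
Proof.
  apply sum_n_eq. intros n _. rewrite Rmult_0_r, cos_0. unfold Rdiv. ring.
Qed.

Lemma sin_sum_at0 (p N : nat) : sin_sum p N 0 = 0.
Proof.
  apply sum_n_eq0. intros n. rewrite Rmult_0_r, sin_0. unfold Rdiv. ring.
Qed.

Lemma is_derive_cos_sum (p N : nat) (x : R) :
  is_derive (cos_sum (S p) N) x (- sin_sum p N x).
Proof.
  unfold cos_sum, sin_sum.
  replace (- sum_n (fun n => sin (odd_nat n * x) / odd_nat n ^ p) N)
    with (sum_n (fun n => - (sin (odd_nat n * x) / odd_nat n ^ p)) N).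
  - apply (is_derive_sum_n
             (fun n y => cos (odd_nat n * y) / odd_nat n ^ (S p))).
    intros n _. auto_derive.
    + exact I.
    + simpl. field.
      split; [apply pow_odd_nat_neq0 | generalize (odd_nat_ge1 n); lra].
  - apply sum_n_opp.
Qed.

Lemma is_derive_sin_sum (p N : nat) (x : R) :
  is_derive (sin_sum (S p) N) x (cos_sum p N x).
Proof.
  unfold cos_sum, sin_sum.
  apply (is_derive_sum_n
           (fun n y => sin (odd_nat n * y) / odd_nat n ^ (S p))).
  intros n _. auto_derive.
  - exact I.
  - simpl. field.
    split; [apply pow_odd_nat_neq0 | generalize (odd_nat_ge1 n); lra].
Qed.

Lemma is_derive_pow_fact (n : nat) (x : R) :
  is_derive (pow_fact (S n)) x (pow_fact n x).
Proof.
  unfold pow_fact. auto_derive; [exact I|].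
  change (fact n + n * fact n)%nat with (S n * fact n)%nat. rewrite mult_INR.
  change (match n with 0%nat => 1 | S _ => INR n + 1 end) with (INR (S n)).
  field. split; [apply INR_fact_neq_0 | apply not_0_INR; lia].
Qed.

Lemma pow_fact_at0 (n : nat) : pow_fact (S n) 0 = 0.
Proof. unfold pow_fact. simpl pow. unfold Rdiv. ring. Qed.

(** * The triangle wave *)

Lemma Rabs_increment_le (f df : R -> R) (a b B : R) :
  a <= b ->
  (forall x, a <= x <= b -> is_derive f x (df x)) ->
  (forall x, a <= x <= b -> Rabs (df x) <= B) ->
  Rabs (f b - f a) <= B * (b - a).
Proof.
  intros Hab Hd HB.
  destruct (MVT_gen f a b df) as [c [Hc E]].
  - rewrite Rmin_left, Rmax_right by lra. intros x Hx. apply Hd. lra.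
  - rewrite Rmin_left, Rmax_right by lra. intros x Hx.
    apply derivable_continuous_pt. exists (df x). apply is_derive_Reals, Hd, Hx.
  - rewrite Rmin_left, Rmax_right in Hc by lra.
    rewrite E, Rabs_mult, (Rabs_pos_eq (b - a)) by lra.
    apply Rmult_le_compat_r; [lra | now apply HB].
Qed.

(** The sum telescopes, as
    [2 sin x cos((k+1)x) = sin((k+2)x) - sin(kx)]. *)
Lemma dirichlet_kernel (N : nat) (x : R) :
  2 * sin x * cos_sum 0 N x = sin (2 * INR (S N) * x).
Proof.
  unfold cos_sum. induction N as [|N IH].
  - rewrite sum_n_R0. unfold odd_nat. simpl.
    replace (2 * 1 * x) with (2 * x) by ring.
    rewrite sin_2a, Rmult_1_l. field.
  - rewrite sum_n_S, Rmult_plus_distr_l, IH.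
    rewrite (S_INR (S N)).
    replace (odd_nat (S N)) with (2 * INR (S N) + 1)
      by (unfold odd_nat; rewrite plus_INR, mult_INR; simpl (INR 2); simpl (INR 1); ring).
    set (k := 2 * INR (S N)).
    replace (k * x) with ((k + 1) * x - x) by ring.
    replace (2 * (INR (S N) + 1) * x) with ((k + 1) * x + x) by (unfold k; ring).
    rewrite sin_plus, sin_minus. simpl. field.
Qed.

(** The derivative of [sin_sum 1 N] is [sin(2Kt) / (2 sin t)] with [K = N + 1]
    by the Dirichlet kernel.  One integration by parts gains the factor [1/K]:
    adding [cos(2Kt) / (4K sin t)], itself of size [1/K], to the sum cancels the
    oscillating derivative and leaves one of size [1/K]. *)
Lemma sin_sum_near_half_PI (d x : R) (N : nat) :
  0 < d -> d <= x <= PI / 2 ->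
  Rabs (sin_sum 1 N x - sin_sum 1 N (PI / 2)) <= 2 / (sin d ^ 2 * INR (S N)).
Proof.
  intros Hd Hx.
  assert (Hpi := PI_RGT_0).
  set (K := INR (S N)). assert (HK : 0 < K) by (apply lt_0_INR; lia).
  assert (Hs : forall t, d <= t <= PI / 2 -> 0 < sin d <= sin t).
  { intros t Ht. split; [apply sin_gt_0; lra | apply sin_incr_1; lra]. }
  pose (s := sin d). assert (H0s : 0 < s) by (apply (Hs x Hx)).
  assert (Hs1 : s <= 1) by (apply SIN_bound).
  pose (h := fun t => cos (2 * K * t) / (4 * K * sin t)).
  pose (G := fun t => sin_sum 1 N t + h t).
  pose (dG := fun t => - (cos (2 * K * t) * cos t) / (4 * K * sin t ^ 2)).
  assert (Hinv : forall t, d <= t <= PI / 2 -> / (4 * K * sin t ^ 2) <= / (4 * K * s ^ 2)).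
  { intros t Ht. apply Rinv_le_contravar.
    - apply Rmult_lt_0_compat; [lra | apply pow_lt; lra].
    - apply Rmult_le_compat_l; [lra|]. apply pow_incr. destruct (Hs t Ht); unfold s; lra. }
  assert (HdG : Rabs (G (PI / 2) - G x) <= / (4 * K * s ^ 2) * (PI / 2 - x)).
  { apply Rabs_increment_le with dG; [lra | |].
    - intros t Ht. assert (Hst := Hs t ltac:(lra)).
      unfold G. evar_last.
      + apply (is_derive_plus (sin_sum 1 N) h t (cos_sum 0 N t)).
        * apply is_derive_sin_sum.
        * unfold h. auto_derive; [|reflexivity].
          apply Rmult_integral_contrapositive; split; lra.
      + assert (E := dirichlet_kernel N t). fold K in E.
        unfold plus; simpl. unfold dG.
        replace (cos_sum 0 N t) with (sin (2 * K * t) / (2 * sin t))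
          by (rewrite <- E; field; lra).
        field. split; lra.
    - intros t Ht. unfold dG. unfold Rdiv. rewrite Rabs_mult, Rabs_Ropp, Rabs_mult.
      rewrite (Rabs_pos_eq (/ _)).
      2:{ left. apply Rinv_0_lt_compat, Rmult_lt_0_compat; [lra|].
          apply pow_lt. generalize (Hs t ltac:(lra)). lra. }
      assert (Hc1 : Rabs (cos (2 * K * t)) <= 1) by (apply Rabs_le, COS_bound).
      assert (Hc2 : Rabs (cos t) <= 1) by (apply Rabs_le, COS_bound).
      assert (Rabs (cos (2 * K * t)) * Rabs (cos t) <= 1).
      { generalize (Rabs_pos (cos (2 * K * t))) (Rabs_pos (cos t)). nra. }
      rewrite <- (Rmult_1_l (/ (4 * K * s ^ 2))).
      apply Rmult_le_compat; try lra.
      + apply Rmult_le_pos; apply Rabs_pos.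
      + left. apply Rinv_0_lt_compat, Rmult_lt_0_compat; [lra|].
        apply pow_lt. generalize (Hs t ltac:(lra)). lra.
      + apply Hinv. lra. }
  assert (Hh : forall t, d <= t <= PI / 2 -> Rabs (h t) <= / (4 * K * s ^ 2)).
  { intros t Ht. assert (Hst := Hs t Ht). fold s in Hst.
    unfold h, Rdiv. rewrite Rabs_mult.
    assert (Hp : 0 < / (4 * K * sin t)) by (apply Rinv_0_lt_compat; nra).
    rewrite (Rabs_pos_eq (/ _)) by lra.
    rewrite <- (Rmult_1_l (/ (4 * K * s ^ 2))).
    apply Rmult_le_compat; try lra.
    - apply Rabs_pos.
    - apply Rabs_le, COS_bound.
    - apply Rinv_le_contravar; [apply Rmult_lt_0_compat; [lra | apply pow_lt; lra]|].
      apply Rmult_le_compat_l; [lra|]. nra. }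
  assert (H1 := Hh x Hx). assert (H2 := Hh (PI / 2) ltac:(lra)).
  assert (HP4 := PI_4).
  set (q := / (4 * K * s ^ 2)) in *.
  assert (Hq : 0 < q).
  { apply Rinv_0_lt_compat, Rmult_lt_0_compat; [lra | apply pow_lt; lra]. }
  replace (2 / (sin d ^ 2 * K)) with (8 * q)
    by (unfold q; fold s; field; lra).
  unfold G in HdG.
  assert (q * (PI / 2 - x) <= q * 2) by (apply Rmult_le_compat_l; lra).
  apply Rabs_le. apply Rabs_le_between in HdG, H1, H2. lra.
Qed.

(** At [PI / 2] the sines alternate between [1] and [-1], which gives the Leibniz
    series. *)
Lemma is_lim_sin_sum_half_PI :
  is_lim_seq (fun N => sin_sum 1 N (PI / 2)) (PI / 4).
Proof.
  apply is_lim_seq_ext with (fun N => sum_f_R0 (tg_alt PI_tg) N).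
  - intros N. rewrite <- sum_n_Reals. apply sum_n_eq. intros n _.
    unfold tg_alt, PI_tg. fold (odd_nat n). rewrite pow_1. unfold Rdiv at 1. f_equal.
    induction n as [|n IH].
    + unfold odd_nat. simpl. now rewrite Rmult_1_l, sin_PI2.
    + rewrite odd_nat_S, Rmult_plus_distr_r.
      replace (2 * (PI / 2)) with PI by field.
      rewrite neg_sin, <- IH. simpl. ring.
  - apply is_lim_seq_Reals.
    rewrite <- Alt_PI_eq. unfold Alt_PI. destruct exist_PI as [l Hl].
    now replace (4 * l / 4) with l by field.
Qed.

Lemma cos_sum_half_PI (p N : nat) : cos_sum p N (PI / 2) = 0.
Proof.
  assert (H : forall n, cos (odd_nat n * (PI / 2)) = 0).
  { induction n as [|n IH].
    - unfold odd_nat. simpl. now rewrite Rmult_1_l, cos_PI2.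
    - rewrite odd_nat_S, Rmult_plus_distr_r.
      replace (2 * (PI / 2)) with PI by field. rewrite neg_cos, IH. ring. }
  apply sum_n_eq0. intros n. rewrite H. unfold Rdiv. ring.
Qed.

Lemma is_derive_triangle_gap (N : nat) (x : R) :
  is_derive (fun y => cos_sum 2 N y - PI / 4 * (PI / 2 - y)) x
    (- sin_sum 1 N x + PI / 4).
Proof.
  evar_last.
  - apply (is_derive_minus (cos_sum 2 N) (fun y => PI / 4 * (PI / 2 - y))).
    + apply is_derive_cos_sum.
    + auto_derive; [exact I | reflexivity].
  - unfold minus, plus, opp; simpl. ring.
Qed.

Lemma is_lim_inv_INR_S : is_lim_seq (fun n => / INR (S n)) 0.
Proof.
  apply (is_lim_seq_incr_1 (fun n => / INR n)).
  apply is_lim_seq_inv with (l := p_infty); [apply is_lim_seq_INR | discriminate].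
Qed.

(** The gap between the partial sum and the triangle wave vanishes at [PI / 2]
    and its derivative tends to [0] uniformly on [[d, PI / 2]], so the gap
    tends to [0] at [d]. *)
Lemma is_lim_cos_sum2 (d : R) :
  0 < d <= PI / 2 ->
  is_lim_seq (fun N => cos_sum 2 N d) (PI / 4 * (PI / 2 - d)).
Proof.
  intros Hd.
  pose (eta := fun N => Rabs (sin_sum 1 N (PI / 2) - PI / 4)
                        + 2 / sin d ^ 2 * / INR (S N)).
  assert (Hs : 0 < sin d) by (apply sin_gt_0; generalize PI_RGT_0; lra).
  assert (Heta : is_lim_seq eta 0).
  { replace (Finite 0) with (Finite (0 + 2 / sin d ^ 2 * 0)) by (f_equal; ring).
    apply is_lim_seq_plus'.
    - apply is_lim_seq_abs_0 with (u := fun N => sin_sum 1 N (PI / 2) - PI / 4).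
      replace 0 with (PI / 4 - PI / 4) by ring.
      apply is_lim_seq_minus'; [apply is_lim_sin_sum_half_PI | apply is_lim_seq_const].
    - apply (is_lim_seq_scal_l (fun N => / INR (S N)) _ (Finite 0)).
      apply is_lim_inv_INR_S. }
  assert (Hb : forall N, Rabs (cos_sum 2 N d - PI / 4 * (PI / 2 - d)) <= eta N * 2).
  { intros N.
    assert (HB : Rabs ((cos_sum 2 N (PI / 2) - PI / 4 * (PI / 2 - PI / 2))
                       - (cos_sum 2 N d - PI / 4 * (PI / 2 - d)))
                 <= eta N * (PI / 2 - d)).
    { apply (Rabs_increment_le
               (fun x => cos_sum 2 N x - PI / 4 * (PI / 2 - x))
               (fun x => - sin_sum 1 N x + PI / 4)); [lra | |].
      - intros x _. apply is_derive_triangle_gap.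
      - intros x Hx. assert (H := sin_sum_near_half_PI d x N ltac:(lra) Hx).
        unfold eta.
        replace (2 / sin d ^ 2 * / INR (S N)) with (2 / (sin d ^ 2 * INR (S N)))
          by (field; split; [apply not_0_INR; lia | lra]).
        replace (- sin_sum 1 N x + PI / 4)
          with (- (sin_sum 1 N (PI / 2) - PI / 4)
                - (sin_sum 1 N x - sin_sum 1 N (PI / 2))) by ring.
        eapply Rle_trans; [apply Rabs_triang|]. rewrite !Rabs_Ropp. lra. }
    rewrite cos_sum_half_PI in HB.
    replace (0 - PI / 4 * (PI / 2 - PI / 2) - (cos_sum 2 N d - PI / 4 * (PI / 2 - d)))
      with (- (cos_sum 2 N d - PI / 4 * (PI / 2 - d))) in HB by ring.
    rewrite Rabs_Ropp in HB. eapply Rle_trans; [exact HB|].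
    apply Rmult_le_compat_l.
    - unfold eta. apply Rplus_le_le_0_compat; [apply Rabs_pos|].
      left. apply Rmult_lt_0_compat.
      + apply Rdiv_lt_0_compat; [lra | now apply pow_lt].
      + apply Rinv_0_lt_compat, lt_0_INR. lia.
    - generalize PI_4. lra. }
  set (l := PI / 4 * (PI / 2 - d)) in *. rewrite <- (Rplus_0_l l).
  apply is_lim_seq_ext with (fun N => (cos_sum 2 N d - l) + l).
  { intros N; ring. }
  apply is_lim_seq_plus'; [|apply is_lim_seq_const].
  apply is_lim_seq_abs_0.
  apply is_lim_seq_le_le with (fun _ => 0) (fun N => eta N * 2).
  - intros N; split; [apply Rabs_pos | apply Hb].
  - apply is_lim_seq_const.
  - rewrite <- (Rmult_0_l 2). now apply (is_lim_seq_scal_r eta 2 (Finite 0)).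
Qed.

Lemma odd_sum_incr (p N : nat) : odd_sum p N <= odd_sum p (S N).
Proof.
  unfold odd_sum. rewrite sum_n_S.
  generalize (Rinv_0_lt_compat _ (pow_odd_nat_gt0 (S N) p)). lra.
Qed.

(** Telescoping: [1 / (2n+1)^2 <= 1 / (n (n+1)) = 1/n - 1/(n+1)]. *)
Lemma odd_sum_bounded (p N : nat) : odd_sum (S (S p)) N <= 2.
Proof.
  assert (Hle : forall n, / odd_nat n ^ (S (S p)) <= / odd_nat n ^ 2).
  { intros n. apply Rinv_le_contravar; [apply pow_odd_nat_gt0|].
    apply Rle_pow; [apply odd_nat_ge1 | lia]. }
  enough (H : odd_sum (S (S p)) N <= 2 - / INR (S N)).
  { generalize (Rinv_0_lt_compat (INR (S N)) ltac:(apply lt_0_INR; lia)). lra. }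
  unfold odd_sum. induction N as [|N IH].
  - rewrite sum_n_R0. eapply Rle_trans; [apply Hle|]. unfold odd_nat. simpl. lra.
  - rewrite sum_n_S. specialize (Hle (S N)).
    assert (HN : 0 < INR (S N)) by (apply lt_0_INR; lia).
    enough (/ odd_nat (S N) ^ 2 <= / INR (S N) - / INR (S (S N))) by lra.
    rewrite (S_INR (S N)).
    replace (/ INR (S N) - / (INR (S N) + 1)) with (/ (INR (S N) * (INR (S N) + 1)))
      by (field; lra).
    apply Rinv_le_contravar; [nra|].
    unfold odd_nat. rewrite plus_INR, mult_INR. simpl (INR 2). simpl (INR 1). nra.
Qed.

Lemma ex_series_odd (p : nat) : ex_series (fun n => / odd_nat n ^ (S (S p))).
Proof.
  destruct (ex_finite_lim_seq_incr (odd_sum (S (S p))) 2) as [l Hl].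
  - apply odd_sum_incr.
  - apply odd_sum_bounded.
  - now exists l.
Qed.

Definition odd_series (p : nat) : R := Series (fun n => / odd_nat n ^ p).

Lemma is_lim_odd_sum (p : nat) :
  is_lim_seq (odd_sum (S (S p))) (odd_series (S (S p))).
Proof. exact (Series_correct _ (ex_series_odd p)). Qed.

Lemma cos_sum_tail (p N M : nat) (x : R) :
  (N <= M)%nat ->
  Rabs (cos_sum p M x - cos_sum p N x) <= odd_sum p M - odd_sum p N.
Proof.
  intros H. induction H as [|M H IH].
  - rewrite !Rminus_diag, Rabs_R0. lra.
  - unfold cos_sum, odd_sum in *. rewrite !sum_n_S.
    set (c := sum_n _ M) in *. set (c0 := sum_n _ N) in *.
    set (o := sum_n _ M) in *. set (o0 := sum_n _ N) in *.
    assert (Ht : Rabs (cos (odd_nat (S M) * x) / odd_nat (S M) ^ p) <= / odd_nat (S M) ^ p).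
    { assert (Hi := Rinv_0_lt_compat _ (pow_odd_nat_gt0 (S M) p)).
      unfold Rdiv. rewrite Rabs_mult, (Rabs_pos_eq (/ _)) by lra.
      assert (Hc : Rabs (cos (odd_nat (S M) * x)) <= 1) by (apply Rabs_le, COS_bound).
      nra. }
    set (t := _ / _) in *.
    replace (c + t - c0) with ((c - c0) + t) by ring.
    eapply Rle_trans; [apply Rabs_triang|]. lra.
Qed.

(** For [0 < x] the bound is the tail estimate [cos_sum_tail] passed to the
    limit.  Its right-hand side does not depend on [x] and the left-hand side is
    continuous, so it extends to [x = 0], where the pointwise limit could not be
    obtained from the kernel, which is singular there. *)
Lemma cos_sum2_uniform (N : nat) (x : R) :
  0 <= x <= PI / 2 ->
  Rabs (cos_sum 2 N x - PI / 4 * (PI / 2 - x)) <= odd_series 2 - odd_sum 2 N.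
Proof.
  assert (Hpos : forall x, 0 < x <= PI / 2 ->
    Rabs (cos_sum 2 N x - PI / 4 * (PI / 2 - x)) <= odd_series 2 - odd_sum 2 N).
  { clear x. intros x Hx.
    assert (L1 : is_lim_seq (fun M => Rabs (cos_sum 2 N x - cos_sum 2 M x))
                   (Rabs (cos_sum 2 N x - PI / 4 * (PI / 2 - x)))).
    { apply (is_lim_seq_abs _ (Finite _)).
      apply is_lim_seq_minus'; [apply is_lim_seq_const | now apply is_lim_cos_sum2]. }
    assert (L2 : is_lim_seq (fun M => odd_sum 2 M - odd_sum 2 N)
                   (odd_series 2 - odd_sum 2 N)).
    { apply is_lim_seq_minus'; [apply is_lim_odd_sum | apply is_lim_seq_const]. }
    refine (is_lim_seq_le_loc _ _ _ _ _ L1 L2).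
    exists N. intros M HM. rewrite Rabs_minus_sym. now apply cos_sum_tail. }
  intros [[H0|<-] H1]; [now apply Hpos|].
  pose (g := fun x => cos_sum 2 N x - PI / 4 * (PI / 2 - x)).
  assert (Hcont : continuity_pt g 0).
  { apply derivable_continuous_pt. exists (- sin_sum 1 N 0 + PI / 4).
    apply is_derive_Reals, is_derive_triangle_gap. }
  assert (L := is_lim_seq_abs _ _ (is_lim_seq_continuous g _ 0 Hcont is_lim_inv_INR_S)).
  refine (is_lim_seq_le _ _ _ _ _ L (is_lim_seq_const _)).
  intros n. apply Hpos. split; [apply Rinv_0_lt_compat, lt_0_INR; lia|].
  assert (/ INR (S n) <= 1).
  { rewrite <- Rinv_1. apply Rinv_le_contravar; [lra|].
    rewrite S_INR. generalize (pos_INR n). lra. }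
  generalize PI2_1. lra.
Qed.

(** * Repeated integration *)

(** The truncation at [N] of the difference between [(-1)^(m+1) S_m] and its
    expected expansion at [0]; the values [lambda(2k+2)] are truncated at the
    same [N], so that [taylor_gap (S m) N] and its derivative vanish exactly
    at [0]. *)
Definition taylor_gap (m N : nat) (x : R) : R :=
  (-1) ^ (m + 1) * cos_sum (2 * m + 2) N x
  - sum_n (fun k => (-1) ^ (k + 1) * odd_sum (2 * k + 2) N
                    * pow_fact (2 * m - 2 * k) x) m
  - PI / 4 * pow_fact (2 * m + 1) x.

Definition taylor_gap' (m N : nat) (x : R) : R :=
  (-1) ^ (m + 1) * sin_sum (2 * m + 3) N x
  - sum_n (fun k => (-1) ^ (k + 1) * odd_sum (2 * k + 2) N
                    * pow_fact (S (2 * m - 2 * k)) x) m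
  - PI / 4 * pow_fact (2 * m + 2) x.

(** The constant term [k = m + 1] is split off, since it is the one that
    disappears on differentiation. *)
Lemma taylor_gap_S (m N : nat) (x : R) :
  taylor_gap (S m) N x =
  (-1) ^ (m + 2) * (cos_sum (2 * m + 4) N x - odd_sum (2 * m + 4) N)
  - sum_n (fun k => (-1) ^ (k + 1) * odd_sum (2 * k + 2) N
                    * pow_fact (S (S (2 * m - 2 * k))) x) m
  - PI / 4 * pow_fact (2 * m + 3) x.
Proof.
  unfold taylor_gap. rewrite sum_n_S.
  replace (2 * S m - 2 * S m)%nat with 0%nat by lia.
  replace (S m + 1)%nat with (m + 2)%nat by lia.
  replace (2 * S m + 2)%nat with (2 * m + 4)%nat by lia.
  replace (2 * S m + 1)%nat with (2 * m + 3)%nat by lia.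
  rewrite (sum_n_eq
             (fun k => (-1) ^ (k + 1) * odd_sum (2 * k + 2) N
                       * pow_fact (2 * S m - 2 * k) x)
             (fun k => (-1) ^ (k + 1) * odd_sum (2 * k + 2) N
                       * pow_fact (S (S (2 * m - 2 * k))) x)).
  - unfold pow_fact at 2. simpl (x ^ 0 / INR (fact 0)). field.
  - intros k Hk. do 2 f_equal. lia.
Qed.

Lemma is_derive_taylor_gap (m N : nat) (x : R) :
  is_derive (taylor_gap (S m) N) x (taylor_gap' m N x).
Proof.
  apply is_derive_ext with (1 := fun t => eq_sym (taylor_gap_S m N t)).
  evar_last.
  - apply @is_derive_minus; [apply @is_derive_minus|].
    + apply is_derive_scal. apply @is_derive_minus; [|apply is_derive_const].
      replace (2 * m + 4)%nat with (S (2 * m + 3)) by lia.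
      apply is_derive_cos_sum.
    + apply (is_derive_sum_n
               (fun k y => (-1) ^ (k + 1) * odd_sum (2 * k + 2) N
                           * pow_fact (S (S (2 * m - 2 * k))) y)).
      intros k _. apply is_derive_scal, is_derive_pow_fact.
    + apply is_derive_scal.
      replace (2 * m + 3)%nat with (S (2 * m + 2)) by lia.
      apply is_derive_pow_fact.
  - pose (t := sum_n (fun k => (-1) ^ (k + 1) * odd_sum (2 * k + 2) N
                               * pow_fact (S (2 * m - 2 * k)) x) m : R).
    change ((-1) ^ (m + 2) * (- sin_sum (2 * m + 3) N x - 0) - t
              - PI / 4 * pow_fact (2 * m + 2) x
            = (-1) ^ (m + 1) * sin_sum (2 * m + 3) N x - t
              - PI / 4 * pow_fact (2 * m + 2) x).
    rewrite !pow_add. ring.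
Qed.

Lemma is_derive_taylor_gap' (m N : nat) (x : R) :
  is_derive (taylor_gap' m N) x (taylor_gap m N x).
Proof.
  unfold taylor_gap', taylor_gap. evar_last.
  - apply @is_derive_minus; [apply @is_derive_minus|].
    + apply is_derive_scal.
      replace (2 * m + 3)%nat with (S (2 * m + 2)) by lia.
      apply is_derive_sin_sum.
    + apply (is_derive_sum_n
               (fun k y => (-1) ^ (k + 1) * odd_sum (2 * k + 2) N
                           * pow_fact (S (2 * m - 2 * k)) y)).
      intros k _. apply is_derive_scal, is_derive_pow_fact.
    + apply is_derive_scal.
      replace (2 * m + 2)%nat with (S (2 * m + 1)) by lia.
      apply is_derive_pow_fact.
  - reflexivity.
Qed.

Lemma taylor_gap_at0 (m N : nat) : taylor_gap (S m) N 0 = 0.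
Proof.
  rewrite taylor_gap_S, cos_sum_at0, sum_n_eq0.
  - replace (2 * m + 3)%nat with (S (2 * m + 2)) by lia. rewrite pow_fact_at0. ring.
  - intros k. rewrite pow_fact_at0. ring.
Qed.

Lemma taylor_gap'_at0 (m N : nat) : taylor_gap' m N 0 = 0.
Proof.
  unfold taylor_gap'. rewrite sin_sum_at0, sum_n_eq0.
  - replace (2 * m + 2)%nat with (S (2 * m + 1)) by lia. rewrite pow_fact_at0. ring.
  - intros k. rewrite pow_fact_at0. ring.
Qed.

(** Each of the two integrations from [0] costs at most a factor [2], the
    length of [[0, PI / 2]] being at most [2]. *)
Lemma taylor_gap_bound (m N : nat) (x : R) :
  0 <= x <= PI / 2 ->
  Rabs (taylor_gap m N x) <= 2 * (odd_series 2 - odd_sum 2 N) * 4 ^ m.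
Proof.
  set (tau := odd_series 2 - odd_sum 2 N).
  assert (HP := PI_RGT_0). assert (HP4 := PI_4).
  (* A function vanishing at 0 is bounded by twice a bound on its derivative. *)
  assert (integrate : forall (f df : R -> R) B, 0 <= B -> f 0 = 0 ->
    (forall t, is_derive f t (df t)) ->
    (forall t, 0 <= t <= PI / 2 -> Rabs (df t) <= B) ->
    forall t, 0 <= t <= PI / 2 -> Rabs (f t) <= B * 2).
  { intros f df B HB f0 Hd Hb t Ht.
    replace (f t) with (f t - f 0) by (rewrite f0; ring).
    apply Rle_trans with (B * (t - 0)); [|apply Rmult_le_compat_l; lra].
    apply Rabs_increment_le with df; [lra | now intros | ].
    intros s Hs. apply Hb. lra. }
  assert (Htau : 0 <= tau).
  { eapply Rle_trans; [apply Rabs_pos|]. apply (cos_sum2_uniform N 0). lra. }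
  revert x. induction m as [|m IH]; intros x Hx.
  - assert (H1 := cos_sum2_uniform N x Hx).
    assert (H2 := cos_sum2_uniform N 0 ltac:(lra)).
    fold tau in H1, H2. rewrite cos_sum_at0 in H2.
    unfold taylor_gap. rewrite sum_n_R0. unfold pow_fact. simpl.
    apply Rabs_le. apply Rabs_le_between in H1, H2. lra.
  - assert (0 < 4 ^ m) by (apply pow_lt; lra).
    replace (2 * tau * 4 ^ S m) with (2 * tau * 4 ^ m * 2 * 2) by (simpl; ring).
    apply (integrate (taylor_gap (S m) N) (taylor_gap' m N)); try apply taylor_gap_at0;
      auto using is_derive_taylor_gap.
    { repeat apply Rmult_le_pos; lra. }
    apply (integrate (taylor_gap' m N) (taylor_gap m N)); try apply taylor_gap'_at0;
      auto using is_derive_taylor_gap'.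
    repeat apply Rmult_le_pos; lra.
Qed.

Lemma is_lim_taylor_gap (m : nat) (x : R) :
  0 <= x <= PI / 2 -> is_lim_seq (fun N => taylor_gap m N x) 0.
Proof.
  intros Hx. apply is_lim_seq_abs_0.
  apply is_lim_seq_le_le with (fun _ => 0)
    (fun N => 2 * (odd_series 2 - odd_sum 2 N) * 4 ^ m).
  - intros N; split; [apply Rabs_pos | now apply taylor_gap_bound].
  - apply is_lim_seq_const.
  - replace (Finite 0) with (Rbar_mult (2 * (odd_series 2 - odd_series 2)) (4 ^ m))
      by (simpl; f_equal; ring).
    apply is_lim_seq_scal_r.
    apply (is_lim_seq_scal_l (fun N => odd_series 2 - odd_sum 2 N) 2 (odd_series 2 - odd_series 2)).
    apply is_lim_seq_minus'; [apply is_lim_seq_const | apply is_lim_odd_sum].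
Qed.

Lemma is_lim_seq_sum_n (u : nat -> nat -> R) (l : nat -> R) (m : nat) :
  (forall k, is_lim_seq (u k) (l k)) ->
  is_lim_seq (fun N => sum_n (fun k => u k N) m) (sum_n l m).
Proof.
  intros H. induction m as [|m IH].
  - rewrite sum_n_R0. apply is_lim_seq_ext with (u 0%nat); [|apply H].
    intros N. now rewrite sum_n_R0.
  - rewrite sum_n_S.
    apply is_lim_seq_ext with (fun N => sum_n (fun k => u k N) m + u (S m) N).
    + intros N. now rewrite sum_n_S.
    + now apply is_lim_seq_plus'.
Qed.

Lemma is_lim_cos_sum (m : nat) (x : R) :
  0 <= x <= PI / 2 ->
  is_lim_seq (fun N => (-1) ^ (m + 1) * cos_sum (2 * m + 2) N x)
    (sum_n (fun k => (-1) ^ (k + 1) * odd_series (2 * k + 2)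
                     * pow_fact (2 * m - 2 * k) x) m
     + PI / 4 * pow_fact (2 * m + 1) x).
Proof.
  intros Hx.
  apply is_lim_seq_ext with
    (fun N => taylor_gap m N x
       + (sum_n (fun k => (-1) ^ (k + 1) * odd_sum (2 * k + 2) N
                     * pow_fact (2 * m - 2 * k) x) m
          + PI / 4 * pow_fact (2 * m + 1) x)).
  { intros N. unfold taylor_gap. ring. }
  rewrite <- (Rplus_0_l (sum_n (fun k => (-1) ^ (k + 1) * odd_series _ * _) m + _)).
  apply is_lim_seq_plus'; [now apply is_lim_taylor_gap|].
  apply is_lim_seq_plus'; [|apply is_lim_seq_const].
  apply (is_lim_seq_sum_n (fun k N => (-1) ^ (k + 1) * odd_sum (2 * k + 2) N
                     * pow_fact (2 * m - 2 * k) x)).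
  intros k.
  apply (is_lim_seq_scal_r _ _ (Finite _)), (is_lim_seq_scal_l _ _ (Finite _)).
  replace (2 * k + 2)%nat with (S (S (2 * k))) by lia. apply is_lim_odd_sum.
Qed.

(** * Evaluation at a third of pi *)

(** Among three consecutive odd numbers [6n+1, 6n+3, 6n+5], exactly the middle
    one is a multiple of [3]; writing its coefficient [-1] as [1/2 - 3/2]
    separates the full sum from the sum over [3 (2n+1)]. *)
Lemma cos_sum_third_PI (p M : nat) :
  cos_sum p (3 * M + 2) (PI / 3)
  = / 2 * odd_sum p (3 * M + 2) - 3 / 2 * / 3 ^ p * odd_sum p M.
Proof.
  assert (H3 : forall n, odd_nat (S (3 * n)) = 3 * odd_nat n).
  { intros n. unfold odd_nat. replace (2 * S (3 * n) + 1)%nat with (3 * (2 * n + 1))%nat by lia.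
    rewrite mult_INR. simpl (INR 3). ring. }
  assert (C1 : forall n, cos (odd_nat (S (3 * n)) * (PI / 3)) = -1).
  { intros n. rewrite H3. induction n as [|n IH].
    - unfold odd_nat. simpl. replace (3 * 1 * (PI / 3)) with PI by field. apply cos_PI.
    - rewrite odd_nat_S.
      replace (3 * (odd_nat n + 2) * (PI / 3))
        with (3 * odd_nat n * (PI / 3) + 2 * PI) by field.
      rewrite cos_plus, cos_2PI, sin_2PI, IH. ring. }
  assert (S1 : forall n, sin (odd_nat (S (3 * n)) * (PI / 3)) = 0).
  { intros n. assert (H := sin2_cos2 (odd_nat (S (3 * n)) * (PI / 3))).
    rewrite C1 in H. unfold Rsqr in H. nra. }
  assert (C0 : forall n, cos (odd_nat (3 * n) * (PI / 3)) = / 2).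
  { intros n.
    replace (odd_nat (3 * n) * (PI / 3))
      with (odd_nat (S (3 * n)) * (PI / 3) - 2 * (PI / 3)) by (rewrite odd_nat_S; ring).
    rewrite cos_minus, C1, S1, cos_2PI3. lra. }
  assert (C2 : forall n, cos (odd_nat (S (S (3 * n))) * (PI / 3)) = / 2).
  { intros n. rewrite odd_nat_S, Rmult_plus_distr_r, cos_plus, C1, S1, cos_2PI3. lra. }
  assert (N3 : 3 ^ p <> 0) by (apply pow_nonzero; lra).
  assert (T : forall n,
    cos (odd_nat (3 * n) * (PI / 3)) / odd_nat (3 * n) ^ p
    + cos (odd_nat (S (3 * n)) * (PI / 3)) / odd_nat (S (3 * n)) ^ p
    + cos (odd_nat (S (S (3 * n))) * (PI / 3)) / odd_nat (S (S (3 * n))) ^ p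
    = / 2 * (/ odd_nat (3 * n) ^ p + / odd_nat (S (3 * n)) ^ p + / odd_nat (S (S (3 * n))) ^ p)
      - 3 / 2 * / 3 ^ p * / odd_nat n ^ p).
  { intros n. rewrite C0, C1, C2, H3, Rpow_mult_distr.
    field. repeat split; auto using pow_odd_nat_neq0. }
  unfold cos_sum, odd_sum. induction M as [|M IH].
  - change (3 * 0 + 2)%nat with (S (S 0)). rewrite !sum_n_S, !sum_n_R0.
    exact (T 0%nat).
  - specialize (T (S M)).
    replace (3 * S M + 2)%nat with (S (S (S (3 * M + 2)))) by lia.
    rewrite !sum_n_S, IH.
    replace (3 * S M)%nat with (S (3 * M + 2)) in T by lia. lra.
Qed.

(** The two limits of [(-1)^(m+1) S_m(PI/3)] along the subsequence of partial
    sums with [3M + 3] terms must agree. *)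
Lemma odd_series_recurrence (m : nat) :
  (-1) ^ (m + 1) * 2 * (1 - / 3 ^ (2 * m + 1)) * odd_series (2 * m + 2)
  = PI ^ (2 * m + 2) / (3 ^ (2 * m + 1) * INR (fact (2 * m + 1)))
    + 4 * sum_n (fun k => (-1) ^ (k + 1)
            * (PI ^ (2 * m - 2 * k)
               / (3 ^ (2 * m - 2 * k) * INR (fact (2 * m - 2 * k))))
            * odd_series (2 * k + 2)) m.
Proof.
  assert (HP := PI_RGT_0).
  assert (Hphi : filterlim (fun M => 3 * M + 2)%nat eventually eventually).
  { apply eventually_subseq. intros n. lia. }
  assert (L1 := is_lim_seq_subseq _ _ _ Hphi (is_lim_cos_sum m (PI / 3) ltac:(lra))).
  assert (Hodd : is_lim_seq (odd_sum (2 * m + 2)) (odd_series (2 * m + 2))).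
  { replace (2 * m + 2)%nat with (S (S (2 * m))) by lia. apply is_lim_odd_sum. }
  assert (L2 : is_lim_seq
    (fun M => (-1) ^ (m + 1) * cos_sum (2 * m + 2) (3 * M + 2) (PI / 3))
    ((-1) ^ (m + 1) * (/ 2 * odd_series (2 * m + 2)
       - 3 / 2 * / 3 ^ (2 * m + 2) * odd_series (2 * m + 2)))).
  { apply (is_lim_seq_scal_l _ _ (Finite _)).
    eapply is_lim_seq_ext; [intros M; symmetry; apply cos_sum_third_PI|].
    apply is_lim_seq_minus'; apply (is_lim_seq_scal_l _ _ (Finite _)).
    - exact (is_lim_seq_subseq _ _ _ Hphi Hodd).
    - exact Hodd. }
  apply is_lim_seq_unique in L1, L2. rewrite L1 in L2. apply Rbar_finite_eq in L2 as E.
  assert (N3 : forall n, 3 ^ n <> 0) by (intros n; apply pow_nonzero; lra).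
  assert (Epf : forall n, pow_fact n (PI / 3) = PI ^ n / (3 ^ n * INR (fact n))).
  { intros n. unfold pow_fact, Rdiv. rewrite Rpow_mult_distr, pow_inv.
    field. split; [apply INR_fact_neq_0 | apply N3]. }
  rewrite Epf in E.
  rewrite (sum_n_eq _ (fun k => (-1) ^ (k + 1)
            * (PI ^ (2 * m - 2 * k)
               / (3 ^ (2 * m - 2 * k) * INR (fact (2 * m - 2 * k))))
            * odd_series (2 * k + 2))) in E
    by (intros k _; rewrite Epf; ring).
  replace (2 * m + 2)%nat with (S (2 * m + 1)) in * by lia.
  rewrite <- tech_pow_Rmult in E. rewrite <- tech_pow_Rmult.
  replace (PI * PI ^ (2 * m + 1) / (3 ^ (2 * m + 1) * INR (fact (2 * m + 1))))
    with (4 * (PI / 4 * (PI ^ (2 * m + 1) / (3 ^ (2 * m + 1) * INR (fact (2 * m + 1))))))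
    by (field; split; [apply INR_fact_neq_0 | apply N3]).
  rewrite <- Rmult_plus_distr_l, Rplus_comm, E. field. apply N3.
Qed.

(** * From real series to the Dirichlet lambda function *)

Lemma lambda_term_nat (p n : nat) :
  lambda_term (INR p) n = RtoC (/ odd_nat n ^ p).
Proof.
  assert (E : Rcpow (INR (2 * n + 1)) (INR p) = RtoC (odd_nat n ^ p)).
  { unfold Rcpow, Cexp. rewrite <- RtoC_mult, re_RtoC, im_RtoC, cos_0, sin_0.
    rewrite Rmult_1_r, Rmult_0_r. fold (odd_nat n). unfold RtoC. f_equal.
    rewrite Rmult_comm. rewrite <- Rpower_pow; [|generalize (odd_nat_ge1 n); lra].
    unfold Rpower. f_equal. ring. }
  unfold lambda_term. rewrite E, <- RtoC_div by apply pow_odd_nat_neq0.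
  f_equal. unfold Rdiv. ring.
Qed.

Lemma lambda_nat (p : nat) : lambda (INR p) = RtoC (odd_series p).
Proof.
  apply injective_projections.
  - apply Series_ext. intros n. now rewrite lambda_term_nat, re_RtoC.
  - change (Series (fun n => Im (lambda_term (INR p) n)) = 0).
    apply is_series_unique. apply is_series_ext with (fun _ => 0).
    + intros n. now rewrite lambda_term_nat, im_RtoC.
    + change (is_lim_seq (sum_n (fun _ => 0)) 0).
      apply is_lim_seq_ext with (fun _ => 0).
      * intros N. symmetry. now apply sum_n_eq0.
      * apply is_lim_seq_const.
Qed.

Lemma RtoC_sum_n (f : nat -> R) (N : nat) :
  @sum_n C_AbelianMonoid (fun k => RtoC (f k)) N = RtoC (sum_n f N).
Proof.
  induction N as [|N IH].
  - now rewrite sum_n_R0, sum_O.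
  - rewrite sum_n_S, RtoC_plus, <- IH.
    exact (@sum_Sn C_AbelianMonoid (fun k => RtoC (f k)) N).
Qed.

Theorem theorem1p10 (m : nat) :
  ((-1) ^ (m + 1) * 2 * (1 - / 3 ^ (2 * m + 1))
     * lambda (INR (2 * m + 2))
   = PI ^ (2 * m + 2) / (3 ^ (2 * m + 1) * INR (fact (2 * m + 1)))
     + 4 * sum_n
             (fun k : nat =>
                (-1) ^ (k + 1)
                * (PI ^ (2 * m - 2 * k)
                   / (3 ^ (2 * m - 2 * k) * INR (fact (2 * m - 2 * k))))
                * lambda (INR (2 * k + 2)))
             m)%C.
Proof.
  assert (N3 : forall n, 3 ^ n <> 0) by (intros n; apply pow_nonzero; lra).
  assert (NF : forall n j, 3 ^ n * INR (fact j) <> 0).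
  { intros n j. apply Rmult_integral_contrapositive.
    split; [apply N3 | apply INR_fact_neq_0]. }
  rewrite (sum_n_ext _ (fun k => RtoC ((-1) ^ (k + 1)
            * (PI ^ (2 * m - 2 * k)
               / (3 ^ (2 * m - 2 * k) * INR (fact (2 * m - 2 * k))))
            * odd_series (2 * k + 2)))).
  2:{ intros k. rewrite lambda_nat, !RtoC_mult, RtoC_div, RtoC_mult, !RtoC_pow by apply NF.
      reflexivity. }
  rewrite RtoC_sum_n, lambda_nat, <- !RtoC_pow, <- RtoC_inv, <- !RtoC_mult by apply N3.
  rewrite <- RtoC_div, <- RtoC_minus, <- !RtoC_mult, <- RtoC_plus by apply NF.
  f_equal. apply odd_series_recurrence.
Qed.
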